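(* Let $n\ge 1$ and $N\ge 1$ be integers, let $L>0$ and $\Delta>0$ be real numbers, and let $t_k\in\left(0,\tfrac{\sqrt{3}}{L}\right)$ for $k\in\{1,\ldots,N\}$. Let $f:\mathbb{R}^n\to\mathbb{R}$ be an $L$-smooth function with minimum value $f^\star$, and let $x^1\in\mathbb{R}^n$ satisfy $f(x^1)-f^\star\le\Delta$. Let $x^2,\ldots,x^{N+1}$ be the iterates of the gradient method with fixed step lengths $t_k$, i.e. $x^{k+1}=x^k-t_k\nabla f(x^k)$ for $k\in\{1,\ldots,N\}$. Then $$\min_{1\leq k\leq N+1}\left\|\nabla f(x^k)\right\|\leq \left(\frac{4\Delta}{\sum_{k=1}^N \min\left(-L^2t_k^3+4t_k,\,-Lt_k^2+4t_k\right)+\tfrac{2}{L}}\right)^{\tfrac{1}{2}}.$$ In particular, if $t_k=\tfrac{\sqrt{4/3}}{L}$ for all $k\in\{1,\ldots,N\}$, then $$\min_{1\leq k\leq N+1} \left\|\nabla f(x^k)\right\|\leq \left(\frac{6\sqrt{3}\,L\,(f(x^1)-f^\star)}{8N+3\sqrt{3}}\right)^{\tfrac{1}{2}}.$$ Similarly, if $t_k=\tfrac{1}{L}$ for all $k\in\{1,\ldots,N\}$, then $$\min_{1\leq k\leq N+1} \left\|\nabla f(x^k)\right\|\leq \left(\frac{4L\,(f(x^1)-f^\star)}{3N+2}\right)^{\tfrac{1}{2}}.$$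
   Context: $\langle\cdot,\cdot\rangle$ and $\|\cdot\|$ denote the Euclidean inner product and norm on $\mathbb{R}^n$. A differentiable function $f:\mathbb{R}^n\to\mathbb{R}$ is called $L$-smooth if $\left|f(y)-f(x)-\langle\nabla f(x),y-x\rangle\right|\le\tfrac{L}{2}\|y-x\|^2$ for all $x,y\in\mathbb{R}^n$; equivalently, $\|\nabla f(x)-\nabla f(y)\|\le L\|x-y\|$ for all $x,y\in\mathbb{R}^n$. No convexity of $f$ is assumed. *)

(* Defs.v *)
From HB Require Import structures.
From mathcomp Require Import all_boot all_order all_algebra.
From mathcomp Require Import all_classical all_reals all_analysis.
Set Implicit Arguments. Unset Strict Implicit. Unset Printing Implicit Defensive.
Import Order.TTheory GRing.Theory Num.Theory.
Import numFieldNormedType.Exports.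
Local Open Scope ring_scope.

Section Euclidean.
Context {R : realType} {n : nat}.
Implicit Types (u v x y : 'rV[R]_n) (f : 'rV[R]_n -> R).

Definition dotp u v : R := \sum_(i < n) u 0 i * v 0 i.

(* The canonical norm `|u| on 'rV[R]_n is the sup norm. *)
Definition enorm u : R := Num.sqrt (dotp u u).

Definition gradient f x : 'rV[R]_n := \row_(i < n) 'D_(delta_mx 0 i) f x.

(* [differentiable] is Frechet differentiability for the sup norm, hence, the
   norms on R^n being equivalent, also for the Euclidean one. *)
Definition smooth (L : R) f : Prop :=
  (forall x, differentiable f x) /\
  (forall x y,
     `|f y - f x - dotp (gradient f x) (y - x)| <= L / 2 * enorm (y - x) ^+ 2).

Definition is_min_value f (m : R) : Prop :=
  (exists x, f x = m) /\ (forall y, m <= f y).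

(* The minimum of `||gradient f (x k)||` over 1 <= k <= N + 1; starting the
   iterated minimum at the term of index 1 adds no extra value. *)
Definition min_gradient_norm f (x : nat -> 'rV[R]_n) (N : nat) : R :=
  \big[Num.min/enorm (gradient f (x 1%N))]_(1 <= k < N.+2)
     enorm (gradient f (x k)).

End Euclidean.

(* Main.v *)
(* For an L-smooth f, comparing the quadratic upper model at x with the lower
   model at y gives the interpolation inequality
     f y - f x <= <g + h, y - x> / 2 - |g - h|^2 / (4 L) + L |y - x|^2 / 4
   with g and h the gradients at x and y. Applied both ways to a step
   y = x - t g, it yields
     4 (f x - f y) >= (3 t - L t^2) |g|^2 + t |h|^2 + (1 - L t) / L |g - h|^2
   and |g - h| <= L t |g|. Bounding |g - h|^2 below by 0 if L t <= 1 and above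
   by (L t |g|)^2 otherwise leaves nonnegative coefficients of |g|^2 and |h|^2,
   since L t <= sqrt 3, and their sum is the min in the theorem. Summing over
   the steps and using f (x (N+1)) - fstar >= |g (x (N+1))|^2 / (2 L) gives the
   bound. *)
Require Import Defs.
From HB Require Import structures.
From mathcomp Require Import all_boot all_order all_algebra.
From mathcomp Require Import all_classical all_reals all_analysis.
From mathcomp Require Import ring lra.
Set Implicit Arguments. Unset Strict Implicit. Unset Printing Implicit Defensive.
Import Order.TTheory GRing.Theory Num.Theory.
Import numFieldNormedType.Exports.
Local Open Scope ring_scope.

Lemma dotpC (R : realType) (n : nat) (u v : 'rV[R]_n) : dotp u v = dotp v u.
Proof. by apply: eq_bigr => i _; rewrite mulrC. Qed.

Lemma dotpDl (R : realType) (n : nat) (u v w : 'rV[R]_n) :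
  dotp (u + v) w = dotp u w + dotp v w.
Proof. by rewrite -big_split; apply: eq_bigr => i _; rewrite mxE mulrDl. Qed.

Lemma dotpZl (R : realType) (n : nat) (a : R) (u v : 'rV[R]_n) :
  dotp (a *: u) v = a * dotp u v.
Proof. by rewrite mulr_sumr; apply: eq_bigr => i _; rewrite mxE mulrA. Qed.

Lemma dotpNl (R : realType) (n : nat) (u v : 'rV[R]_n) :
  dotp (- u) v = - dotp u v.
Proof. by rewrite -scaleN1r dotpZl mulN1r. Qed.

Lemma dotpDr (R : realType) (n : nat) (u v w : 'rV[R]_n) :
  dotp w (u + v) = dotp w u + dotp w v.
Proof. by rewrite dotpC dotpDl !(dotpC w). Qed.

Lemma dotpZr (R : realType) (n : nat) (a : R) (u v : 'rV[R]_n) :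
  dotp v (a *: u) = a * dotp v u.
Proof. by rewrite dotpC dotpZl (dotpC v). Qed.

Lemma dotpNr (R : realType) (n : nat) (u v : 'rV[R]_n) :
  dotp v (- u) = - dotp v u.
Proof. by rewrite dotpC dotpNl (dotpC v). Qed.

Lemma dotp_ge0 (R : realType) (n : nat) (u : 'rV[R]_n) : 0 <= dotp u u.
Proof. by apply: sumr_ge0 => i _; rewrite -expr2 sqr_ge0. Qed.

Lemma enorm_sqr (R : realType) (n : nat) (u : 'rV[R]_n) :
  enorm u ^+ 2 = dotp u u.
Proof. by rewrite sqr_sqrtr ?dotp_ge0. Qed.

Definition dotpE := (dotpDl, dotpDr, dotpZl, dotpZr, dotpNl, dotpNr).

Lemma smooth_bounds (R : realType) (n : nat) (L : R) (f : 'rV[R]_n -> R)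
    (x y : 'rV[R]_n) : smooth L f ->
  f x + dotp (gradient f x) (y - x) - L / 2 * dotp (y - x) (y - x) <= f y
  <= f x + dotp (gradient f x) (y - x) + L / 2 * dotp (y - x) (y - x).
Proof.
move=> [_ /(_ x y)]; rewrite enorm_sqr ler_norml => /andP[lo up].
by apply/andP; split; lra.
Qed.

Lemma smooth_interpolation (R : realType) (n : nat) (L : R)
    (f : 'rV[R]_n -> R) (x y : 'rV[R]_n) :
  0 < L -> smooth L f ->
  f y - f x <= dotp (gradient f x + gradient f y) (y - x) / 2
    - dotp (gradient f x - gradient f y) (gradient f x - gradient f y) / (4 * L)
    + L / 4 * dotp (y - x) (y - x).
Proof.
move=> L0 sf; set g := gradient f x; set h := gradient f y; set d := y - x.
have L_neq0 : L != 0 by rewrite gt_eqF.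
(* [z] minimizes the upper model at [x] minus the lower model at [y]. *)
pose z := x + (2^-1 *: d - (2 * L)^-1 *: (g - h)).
have /andP[_] := smooth_bounds x z sf.
have /andP[+ _] := smooth_bounds y z sf.
have -> : z - x = 2^-1 *: d - (2 * L)^-1 *: (g - h) by rewrite /z addrC addKr.
have -> : z - y = - (2^-1 *: d) - (2 * L)^-1 *: (g - h).
  by rewrite /z /d; apply/rowP => i; rewrite !mxE; field.
(* Making [d] opaque keeps the expansion of [dotp] from splitting it back into [y - x]. *)
rewrite -/g -/h; clearbody d; rewrite !dotpE (dotpC h g) => lo up.
(* The gap between the two models at [z] is exactly the right side of the goal minus the left. *)
have := le_trans lo up; rewrite -subr_ge0 -[in X in _ -> X]subr_ge0.
rewrite (dotpC d g) (dotpC d h).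
by congr (0 <= _); field.
Qed.

(* [a], [b], [c] stand for |g|^2, |h|^2, <g, h>, with [g] and [h] the
   gradients at both ends of a step, and [d] for the decrease of [f]. *)
Lemma descent_of_interpolation (R : realType) (L t a b c d m2 : R) :
  0 < L -> 0 < t -> (L * t) ^+ 2 <= 3 -> 0 <= m2 -> m2 <= a -> m2 <= b ->
  0 <= a + b - 2 * c ->
  - d <= - (t * (a + c)) / 2 - (a + b - 2 * c) / (4 * L) + L / 4 * t ^+ 2 * a ->
  d <= t * (a + c) / 2 - (a + b - 2 * c) / (4 * L) + L / 4 * t ^+ 2 * a ->
  m2 * Num.min (- L ^+ 2 * t ^+ 3 + 4 * t) (- L * t ^+ 2 + 4 * t) <= 4 * d.
Proof.
move=> L0 t0 Lt3 m0 ma mb D0 yx xy.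
have L_neq0 : L != 0 by rewrite gt_eqF.
set D := a + b - 2 * c in D0 yx xy.
(* Adding the two inequalities cancels [d] and [c], leaving the Lipschitz bound on the gradient over
   the step. *)
have DL : D <= (L * t) ^+ 2 * a.
  have := lerD yx xy; rewrite -subr_ge0 => H.
  have L2 : 0 <= 2 * L by lra.
  have := mulr_ge0 L2 H; rewrite -[in X in _ -> X]subr_ge0.
  by congr (0 <= _); rewrite /D; field.
(* Here [c] is eliminated through [2 * c = a + b - D]. *)
have key : (3 * t - L * t ^+ 2) * a + t * b + (1 - L * t) / L * D
    <= 4 * d.
  move: yx; rewrite -subr_ge0 => H; have := mulr_ge0 (ler0n R 4) H.
  by rewrite -[in X in _ -> X]subr_ge0; congr (0 <= _); rewrite /D; field.
apply: le_trans key.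
have ? : 0 <= t * (b - m2) by apply: mulr_ge0; [exact: ltW | rewrite subr_ge0].
(* The sign of the coefficient of [D] decides which bound on [D] helps: [D0] or [DL]. *)
have [Lt1|Lt1] := leP (L * t) 1.
  apply: (@le_trans _ _ (m2 * (- L * t ^+ 2 + 4 * t))).
    by rewrite ler_wpM2l // ge_min lexx orbT.
  have ? : 0 <= (1 - L * t) / L * D.
    by rewrite !mulr_ge0 // ?subr_ge0 // invr_ge0 ltW.
  have ? : 0 <= t * (3 - L * t) * (a - m2).
    by rewrite !mulr_ge0 ?subr_ge0 // ?ltW //; lra.
  lra.
apply: (@le_trans _ _ (m2 * (- L ^+ 2 * t ^+ 3 + 4 * t))).
  by rewrite ler_wpM2l // ge_min lexx.
have : 0 <= (L * t - 1) / L * ((L * t) ^+ 2 * a - D).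
  by rewrite !mulr_ge0 ?subr_ge0 ?invr_ge0 // ltW.
have -> : (L * t - 1) / L * ((L * t) ^+ 2 * a - D) =
    (L * t - 1) * L * t ^+ 2 * a + (1 - L * t) / L * D by field.
(* After [DL], the coefficient of [a] collapses to [t * (3 - (L * t) ^+ 2)], which is where the
   limit [sqrt 3] on [L * t] comes from. *)
have ? : 0 <= t * (3 - (L * t) ^+ 2) * (a - m2).
  by rewrite !mulr_ge0 ?subr_ge0 // ltW.
lra.
Qed.

(** A common lower bound [m2] replaces the two gradient norms, so that one constant, the squared
    minimal norm, serves every step and factors out of the sum. *)
Lemma gradient_step_descent (R : realType) (n : nat) (L t m2 : R)
    (f : 'rV[R]_n -> R) (x y : 'rV[R]_n) :
  0 < L -> smooth L f -> 0 < t -> (L * t) ^+ 2 <= 3 ->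
  y = x - t *: gradient f x -> 0 <= m2 ->
  m2 <= enorm (gradient f x) ^+ 2 -> m2 <= enorm (gradient f y) ^+ 2 ->
  m2 * Num.min (- L ^+ 2 * t ^+ 3 + 4 * t) (- L * t ^+ 2 + 4 * t)
  <= 4 * (f x - f y).
Proof.
move=> L0 sf t0 Lt3 yE m0; rewrite !enorm_sqr => ma mb.
have := smooth_interpolation x y L0 sf.
have := smooth_interpolation y x L0 sf.
have := dotp_ge0 (gradient f x - gradient f y).
have -> : y - x = - (t *: gradient f x) by rewrite yE addrC addKr.
have -> : x - y = t *: gradient f x by rewrite yE opprB addrC subrK.
rewrite !dotpE (dotpC (gradient f y) (gradient f x)) => D0 yx xy.
apply: (descent_of_interpolation (c := dotp (gradient f x) (gradient f y))
  L0 t0 Lt3 m0 ma mb); lra.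
Qed.

(** The upper model at [x] is smallest at [x - L^-1 *: g], and [f] is at least [fstar] there. The
    factor 4 matches the step inequality. *)
Lemma smooth_gradient_gap (R : realType) (n : nat) (L fstar : R)
    (f : 'rV[R]_n -> R) (x : 'rV[R]_n) :
  0 < L -> smooth L f -> is_min_value f fstar ->
  enorm (gradient f x) ^+ 2 * (2 / L) <= 4 * (f x - fstar).
Proof.
move=> L0 sf [_ fmin]; rewrite enorm_sqr; set g := gradient f x.
have L_neq0 : L != 0 by rewrite gt_eqF.
have /andP[_] := smooth_bounds x (x - L^-1 *: g) sf.
have := fmin (x - L^-1 *: g).
rewrite -/g [_ - _ - x]addrC addKr !dotpE => lo up.
have := le_trans lo up; rewrite -subr_ge0 => H; have := mulr_ge0 (ler0n R 4) H.
by rewrite -[in X in _ -> X]subr_ge0; congr (0 <= _); field.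
Qed.

Lemma min_gradient_norm_ge0 (R : realType) (n N : nat)
    (f : 'rV[R]_n -> R) (x : nat -> 'rV[R]_n) : 0 <= min_gradient_norm f x N.
Proof. by apply: le_bigmin => *; exact: sqrtr_ge0. Qed.

Lemma min_gradient_norm_sqr_le (R : realType) (n N k : nat)
    (f : 'rV[R]_n -> R) (x : nat -> 'rV[R]_n) : (1 <= k <= N.+1)%N ->
  min_gradient_norm f x N ^+ 2 <= enorm (gradient f (x k)) ^+ 2.
Proof.
move=> kN; rewrite ler_sqr ?nnegrE ?min_gradient_norm_ge0 ?sqrtr_ge0 //.
by apply: ge_bigmin_seq; rewrite // mem_index_iota ltnS.
Qed.

Lemma step_sqr_le3 (R : realType) (L t : R) :
  0 < L -> 0 < t < Num.sqrt 3 / L -> (L * t) ^+ 2 <= 3.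
Proof.
move=> L0 /andP[t0 tL].
rewrite mulrC -[3]sqr_sqrtr // ler_sqr ?nnegrE ?sqrtr_ge0 //.
  by rewrite -ler_pdivlMr // ltW.
by rewrite mulr_ge0 // ltW.
Qed.

(** Keeping the true gap instead of [Delta], with no division, lets all three claims of the theorem
    follow from this one inequality. *)
Lemma min_gradient_norm_bound (R : realType) (n N : nat) (L : R) (t : nat -> R)
    (f : 'rV[R]_n -> R) (fstar : R) (x : nat -> 'rV[R]_n) :
  0 < L ->
  (forall k : nat, (1 <= k <= N)%N -> 0 < t k < Num.sqrt 3 / L) ->
  smooth L f -> is_min_value f fstar ->
  (forall k : nat, (1 <= k <= N)%N ->
     x k.+1 = x k - t k *: gradient f (x k)) ->
  min_gradient_norm f x N ^+ 2 *
    (\sum_(1 <= k < N.+1)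
        Num.min (- L ^+ 2 * t k ^+ 3 + 4 * t k) (- L * t k ^+ 2 + 4 * t k)
     + 2 / L)
  <= 4 * (f (x 1%N) - fstar).
Proof.
move=> L0 tr sf fmin xi; rewrite mulrDr mulr_sumr.
have last : min_gradient_norm f x N ^+ 2 * (2 / L) <=
    4 * (f (x N.+1) - fstar).
  apply: le_trans (smooth_gradient_gap (x N.+1) L0 sf fmin).
  by rewrite ler_wpM2r ?min_gradient_norm_sqr_le ?leqnn ?divr_ge0 // ltW.
have -> : 4 * (f (x 1%N) - fstar) =
    \sum_(1 <= k < N.+1) 4 * (f (x k) - f (x k.+1)) + 4 * (f (x N.+1) - fstar).
  rewrite (@telescope_sumr_eq _ _ _ (fun k => - (4 * f (x k)))) //; first lra.
  by move=> k _; lra.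
apply: lerD last; apply: ler_sum_nat => k /andP[k1 kN].
have kr : (1 <= k <= N)%N by rewrite k1.
have /andP[t0 tL] := tr k kr.
apply: (gradient_step_descent L0 sf t0 _ (xi k kr)).
- exact: step_sqr_le3 (tr k kr).
- exact: sqr_ge0.
- by rewrite min_gradient_norm_sqr_le // k1 ltnW.
- by rewrite min_gradient_norm_sqr_le.
Qed.

Lemma le_sqrt_div (R : realType) (m S D : R) :
  0 < S -> m ^+ 2 * S <= D -> m <= Num.sqrt (D / S).
Proof.
move=> S0; rewrite -ler_pdivlMr // => mD.
by rewrite (le_trans (ler_norm m)) // -sqrtr_sqr ler_wsqrtr.
Qed.

Theorem theorem2 (R : realType) (n N : nat) (L Delta : R) (t : nat -> R)
    (f : 'rV[R]_n -> R) (fstar : R) (x : nat -> 'rV[R]_n)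
    (n_ge1 : (1 <= n)%N) (N_ge1 : (1 <= N)%N) (L_gt0 : 0 < L)
    (Delta_gt0 : 0 < Delta)
    (t_range : forall k : nat, (1 <= k <= N)%N -> 0 < t k < Num.sqrt 3 / L)
    (f_smooth : smooth L f)
    (fstar_min : is_min_value f fstar)
    (x1_gap : f (x 1%N) - fstar <= Delta)
    (x_iter : forall k : nat, (1 <= k <= N)%N ->
       x k.+1 = x k - t k *: gradient f (x k)) :
  [/\ min_gradient_norm f x N <=
        Num.sqrt (4 * Delta /
          (\sum_(1 <= k < N.+1)
              Num.min (- L ^+ 2 * t k ^+ 3 + 4 * t k)
                      (- L * t k ^+ 2 + 4 * t k)
           + 2 / L)),
      (forall k : nat, (1 <= k <= N)%N -> t k = Num.sqrt (4 / 3) / L) ->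
        min_gradient_norm f x N <=
          Num.sqrt (6 * Num.sqrt 3 * L * (f (x 1%N) - fstar) /
                    (8 * N%:R + 3 * Num.sqrt 3))
    & (forall k : nat, (1 <= k <= N)%N -> t k = L^-1) ->
        min_gradient_norm f x N <=
          Num.sqrt (4 * L * (f (x 1%N) - fstar) / (3 * N%:R + 2))].
Proof.
have L_neq0 : L != 0 by rewrite gt_eqF.
have := min_gradient_norm_bound L_gt0 t_range f_smooth fstar_min x_iter.
set S := \sum_(1 <= k < N.+1) _; set m := min_gradient_norm f x N => bound.
have S_const c T : (forall k : nat, (1 <= k <= N)%N -> t k = T) ->
    Num.min (- L ^+ 2 * T ^+ 3 + 4 * T) (- L * T ^+ 2 + 4 * T) = c ->
    S = c * N%:R.
  move=> tT <-; rewrite /S (eq_big_nat _ _ (F2 := fun=>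
    Num.min (- L ^+ 2 * T ^+ 3 + 4 * T) (- L * T ^+ 2 + 4 * T))).
    by rewrite sumr_const_nat subn1 mulr_natr.
  by move=> k kN; rewrite tT.
split.
- apply: le_sqrt_div; last by apply: le_trans bound _; rewrite ler_pM2l.
  (* Both arguments of the minimum are [t k] times a factor that is nonnegative since
     [(L * t k) ^+ 2 <= 3]; the term [2 / L] makes the denominator positive. *)
  rewrite ltr_wpDl ?divr_gt0 // /S big_nat_cond sumr_ge0 // => k.
  rewrite andbT ltnS => kN; have /andP[t0 tL] := t_range k kN.
  have Lt0 : 0 < L * t k by rewrite mulr_gt0.
  have Lt3 := step_sqr_le3 L_gt0 (t_range k kN).
  have Lt2 : L * t k <= 4 by nra.
  rewrite le_min; apply/andP; split.
    have : 0 <= t k * (4 - (L * t k) ^+ 2) by rewrite pmulr_rge0 //; lra.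
    by congr (0 <= _); ring.
  have : 0 <= t k * (4 - L * t k) by rewrite pmulr_rge0 //; lra.
  by congr (0 <= _); ring.
- move=> tT; pose s : R := Num.sqrt 3.
  have s0 : 0 < s by rewrite sqrtr_gt0.
  have s_neq0 : s != 0 by rewrite gt_eqF.
  have s2 : s ^+ 2 = 3 by rewrite sqr_sqrtr.
  (* This makes every quantity rational in [s], with [s ^+ 2 = 3]. *)
  have sT : Num.sqrt (4 / 3) = 2 / s :> R.
    have -> : 4 / 3 = (2 / s) ^+ 2 :> R by rewrite exprMn exprVn s2; field.
    by rewrite sqrtr_sqr ger0_norm // divr_ge0 // ltW.
  have SE : S = 16 / (3 * s * L) * N%:R.
    apply: (S_const _ (2 / s / L)); first by rewrite -sT.
    have -> : - L ^+ 2 * (2 / s / L) ^+ 3 + 4 * (2 / s / L) =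
        (8 - 8 / s ^+ 2) / (s * L) by field; exact/andP.
    have -> : - L * (2 / s / L) ^+ 2 + 4 * (2 / s / L) =
        (8 - 4 / s) / (s * L) by field; exact/andP.
    (* Equivalent to [3 / 2 <= s]; it makes the cubic branch the smaller one. *)
    have ? : 4 / s <= 8 / 3.
      by rewrite ler_pdivrMr //; nra.
    rewrite min_l ?s2; first by field; exact/andP.
    by rewrite ler_pM2r ?invr_gt0 ?mulr_gt0 //; lra.
  rewrite -/s; apply: le_sqrt_div; first by rewrite ltr_wpDl ?mulr_ge0 ?mulr_gt0.
  (* This factor turns [S + 2 / L] into [8 * N%:R + 3 * s]. *)
  have k0 : 0 <= 3 * s * L / 2 by rewrite !mulr_ge0 // ltW.
  move: bound; rewrite SE -subr_ge0 => /(mulr_ge0 k0).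
  rewrite -[in X in _ -> X]subr_ge0; congr (0 <= _); field; exact/andP.
- move=> tT; apply: le_sqrt_div; first by rewrite ltr_wpDl // mulr_ge0.
  (* At [L * t = 1] the two branches of the minimum coincide. *)
  have SE : S = 3 / L * N%:R.
    by apply: (S_const _ _ tT); rewrite min_l; [field | rewrite le_eqVlt; apply/orP; left; apply/eqP; field].
  move: bound; rewrite SE -subr_ge0 => /(mulr_ge0 (ltW L_gt0)).
  by rewrite -[in X in _ -> X]subr_ge0; congr (0 <= _); field.
Qed.
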